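(* Let $X$ be a uniformly perfect metric space with more than one point, let $\Phi$ be an admissible function, and let $F\subseteq X$ be non-empty and totally bounded with $\dim_{\mathrm A}F<\infty$. Then: (i) $\overline{\dim}^\Phi F$ equals the supremum of all $s\ge0$ for which there exists $C\in(0,\infty)$ such that for all $\delta_1>0$ there exist $\delta\in(0,\delta_1)$ and a Borel probability measure $\mu_\delta$ with support $\mathrm{supp}(\mu_\delta)\subseteq F$ such that if $U$ is a Borel subset of $X$ which satisfies $\Phi(\delta)\le|U|\le\delta$ then $\mu_\delta(U)\le C|U|^s$. (ii) $\underline{\dim}^\Phi F$ equals the supremum of all $s\ge0$ for which there exist $C,\delta_1\in(0,\infty)$ such that for all $\delta\in(0,\delta_1)$ there exists a Borel probability measure $\mu_\delta$ with support $\mathrm{supp}(\mu_\delta)\subseteq F$ such that if $U$ is a Borel subset of $X$ satisfying $\Phi(\delta)\le|U|\le\delta$ then $\mu_\delta(U)\le C|U|^s$.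
   Context: For a subset $U$ of a metric space, $|U|$ denotes its diameter, and $B(x,r)$ is the open ball. Convention: $\inf\varnothing=\infty$. A metric space $X$ is uniformly perfect if there is $c\in(0,1)$ such that $B(x,R)\setminus B(x,cR)\neq\varnothing$ for all $x\in X$ and $0<R<|X|$. $N_\delta(F)$ is the smallest number of open balls of radius $\delta/2$ with centres in $F$ needed to cover $F$; $F$ is totally bounded if $N_\delta(F)<\infty$ for all $\delta>0$. A function $\Phi\colon(0,\Delta)\to\mathbb{R}$ (for some $\Delta>0$) is admissible if it is monotonic, $0<\Phi(\delta)\le\delta$ for all $\delta\in(0,\Delta)$, and $\Phi(\delta)/\delta\to0$ as $\delta\to0^+$. The scales $\delta$ in the claim are taken in the domain of $\Phi$. For a non-empty totally bounded $F\subseteq X$ and admissible $\Phi$, the upper $\Phi$-intermediate dimension $\overline{\dim}^\Phi F$ is the infimum of all $s\ge0$ such that for all $\epsilon>0$ there exists $\delta_0\in(0,1]$ (with $(0,\delta_0)$ contained in the domain of $\Phi$) such that for all $\delta\in(0,\delta_0)$ there is a finite or countable cover $\{U_1,U_2,\dots\}$ of $F$ by subsets of $X$ with $\Phi(\delta)\le|U_i|\le\delta$ for all $i$ and $\sum_i|U_i|^s\le\epsilon$. The lower $\Phi$-intermediate dimension $\underline{\dim}^\Phi F$ is the infimum of all $s\ge0$ such that for all $\epsilon>0$ and $\delta_0\in(0,1]$ there exist $\delta\in(0,\delta_0)$ (in the domain of $\Phi$) and such a cover of $F$ with $\Phi(\delta)\le|U_i|\le\delta$ for all $i$ and $\sum_i|U_i|^s\le\epsilon$.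 The Assouad dimension $\dim_{\mathrm A}F$ is the infimum of all $a$ for which there exists $C>0$ such that $N_r(B(x,R)\cap F)\le C(R/r)^a$ for all $x\in F$ and $0<r<R$. *)

(* Defs.v *)
From HB Require Import structures.
From mathcomp Require Import all_boot all_order all_algebra.
From mathcomp Require Import all_classical all_reals all_analysis.

Set Implicit Arguments.
Unset Strict Implicit.
Unset Printing Implicit Defensive.

Import Order.TTheory GRing.Theory Num.Def Num.Theory.
Import numFieldNormedType.Exports.

Local Open Scope classical_set_scope.
Local Open Scope ring_scope.

(* Measurable types carry a distinguished point; on a metric space with more
   than one point the choice of such a point is immaterial. *)
#[short(type="pointedMetricType")]
HB.structure Definition PointedMetric (K : numDomainType) :=
  { M of Pointed M & Metric K M }.

Notation borelType X := (g_sigma_algebraType (@open X)).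

Section MetricNotions.
Context {R : realType} {X : pointedMetricType R}.
Implicit Types (A F S U : set X).

(* The maximum with 0 only matters for the empty set, of diameter 0. *)
Definition diameter A : \bar R :=
  maxe 0%E (ereal_sup [set (mdist p.1 p.2)%:E | p in A `*` A]).

Definition uniformly_perfect : Prop :=
  exists c : R, [/\ 0 < c, c < 1 &
    forall (x : X) (r : R), 0 < r -> (r%:E < diameter [set: X])%E ->
      ball x r `\` ball x (c * r) !=set0].

(* The infimum is +oo when no finite cover exists. *)
Definition covering_number (d : R) A : \bar R :=
  ereal_inf [set (n%:R : R)%:E | n in [set n : nat |
    exists s : seq X, [/\ size s = n, [set` s] `<=` A &
      A `<=` \bigcup_(x in [set` s]) ball x (d / 2)]]].

Definition totally_bounded_set F : Prop :=
  forall d : R, 0 < d -> (covering_number d F < +oo)%E.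

Definition assouad_dimension F : \bar R :=
  ereal_inf [set a%:E | a in [set a : R |
    exists C : R, 0 < C /\
      forall (x : X) (rho r : R), F x -> 0 < r -> r < rho ->
        (covering_number r (ball x rho `&` F) <= (C * (rho / r) `^ a)%:E)%E]].

(* A function on (0, Delta) is encoded as a total function whose values outside
   (0, Delta) are never used. *)
Definition admissible (Delta : R) (Phi : R -> R) : Prop :=
  [/\ 0 < Delta,
      {in `]0, Delta[ &, {homo Phi : x y / x <= y}} \/
        {in `]0, Delta[ &, {homo Phi : x y /~ x <= y}},
      forall d, 0 < d < Delta -> 0 < Phi d <= d &
      Phi d / d @[d --> 0^'+] --> 0].

Definition cover_with_sum_le (Phi : R -> R) F (s eps d : R) : Prop :=
  exists (I : set nat) (U : nat -> set X),
    [/\ F `<=` \bigcup_(i in I) U i,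
        forall i, I i -> ((Phi d)%:E <= diameter (U i) <= d%:E)%E &
        (\esum_(i in I) (diameter (U i) `^ s) <= eps%:E)%E].

Definition upper_intermediate_dimension (Delta : R) (Phi : R -> R) F : \bar R :=
  ereal_inf [set s%:E | s in [set s : R | 0 <= s /\
    forall eps : R, 0 < eps ->
    exists d0 : R, [/\ 0 < d0 <= 1, d0 <= Delta &
      forall d : R, 0 < d < d0 -> cover_with_sum_le Phi F s eps d]]].

Definition lower_intermediate_dimension (Delta : R) (Phi : R -> R) F : \bar R :=
  ereal_inf [set s%:E | s in [set s : R | 0 <= s /\
    forall eps d0 : R, 0 < eps -> 0 < d0 <= 1 ->
    exists d : R, [/\ 0 < d < d0, d < Delta & cover_with_sum_le Phi F s eps d]]].

(* The support is the smallest closed set of full measure. It is a relation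
   because in a non-separable space the intersection of all closed sets of full
   measure need not have full measure. *)
Definition is_support (mu : {measure set (borelType X) -> \bar R}) S : Prop :=
  [/\ closed S, mu (~` S) = 0%E &
      forall A, closed A -> mu (~` A) = 0%E -> S `<=` A].

Definition supported_in (mu : {measure set (borelType X) -> \bar R}) F : Prop :=
  exists S, is_support mu S /\ S `<=` F.

End MetricNotions.

Arguments uniformly_perfect {R} X.

(* Main.v *)
Require Import Defs.
From mathcomp Require Import all_boot all_order all_algebra.
From mathcomp Require Import ring lra.

(* For the lower bounds on the dimensions, a measure with mu(U) <= C|U|^s gives
   1 <= sum_i mu(cl U_i) <= C sum_i |U_i|^s for every admissible cover.

   For the upper bounds, fix delta, take a finite Phi(delta)-net P of F, and
   choose weights on P greedily so that w(V) <= max(|V|, Phi(delta))^s for every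
   V in P of diameter at most delta/(2A), each point of P lying in some V for
   which equality holds. By a finite Vitali argument, disjoint sets V_i with
   equality have the property that the balls of radius A max(|V_i|, Phi(delta))
   around them cover F. Uniform perfectness keeps the diameters of those balls
   above Phi(delta), so they form an admissible cover, whose s-sum is at most
   (2A)^s w(P). If no admissible cover has s-sum at most eps, then w(P) is
   bounded below and w / w(P) is the required measure; sets of diameter between
   delta/(2A) and delta are split into boundedly many smaller ones because
   dim_A F is finite. *)

Set Implicit Arguments.
Unset Strict Implicit.
Unset Printing Implicit Defensive.

Import Order.TTheory GRing.Theory Num.Def Num.Theory.

Local Open Scope ring_scope.

(** * Weights and disjoint subfamilies on finite sets *)

Section FiniteFamilies.
Context {R : realFieldType} {T : finType}.
Implicit Types (V : {set T}) (G H : {set {set T}}) (b : {set T} -> R).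

(** Points are treated one at a time: the weight of [t] is raised by the smallest slack among the
    members of [G] containing [t]. This violates no bound and makes one such member tight. *)
Lemma saturating_weights G b :
  (forall V, V \in G -> 0 <= b V) -> (forall t, exists2 V, V \in G & t \in V) ->
  exists w : T -> R, [/\ forall t, 0 <= w t,
    forall V, V \in G -> \sum_(t in V) w t <= b V &
    forall t, exists V, [/\ V \in G, t \in V & \sum_(u in V) w u = b V]].
Proof.
move=> b0 Gcov.
suff [w [w0 wb wt]] : exists w : T -> R, [/\ forall t, 0 <= w t,
    forall V, V \in G -> \sum_(t in V) w t <= b V &
    forall t, t \in enum T ->
      exists V, [/\ V \in G, t \in V & \sum_(u in V) w u = b V]].
  by exists w; split=> // t; apply: wt; rewrite mem_enum.
elim: (enum T) => [|t s [w [w0 wb ws]]].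
  by exists (fun=> 0); split=> // V VG; rewrite big1 ?b0.
have [V0 V0G tV0] := Gcov t.
pose slack V := b V - \sum_(u in V) w u.
have := @arg_minP _ _ _ V0 [pred V | (V \in G) && (t \in V)] slack.
rewrite /= V0G tV0 => /(_ isT).
case=> V1 /andP[V1G tV1] minV1.
have sumE V : \sum_(u in V) (w u + (if u == t then slack V1 else 0)) =
    \sum_(u in V) w u + (if t \in V then slack V1 else 0).
  rewrite big_split/=; congr (_ + _); rewrite -big_mkcondr/=.
  case: ifPn => tV.
    rewrite (eq_bigl (pred1 t)) ?big_pred1_eq// => u /=.
    by case: eqVneq => [->|]; rewrite ?tV ?andbF.
  by rewrite big1// => u /andP[uV /eqP ut]; rewrite -ut uV in tV.
exists (fun u => w u + (if u == t then slack V1 else 0)); split.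
- by move=> u; case: ifP => _; rewrite ?addr0// addr_ge0// subr_ge0 wb.
- move=> V VG; rewrite sumE; case: ifPn => tV; last by rewrite addr0 wb.
  by rewrite -lerBrDl; apply: minV1; rewrite /= VG.
- move=> u; rewrite inE => /orP[/eqP->|us].
    by exists V1; split=> //; rewrite sumE tV1 addrC subrK.
  have [V [VG uV wV]] := ws u us; exists V; split=> //.
  rewrite sumE; case: ifPn => tV; last by rewrite addr0.
  (* A tight set containing [t] has slack zero, so the minimal slack is zero: sets already tight are
     never spoiled. *)
  suff -> : slack V1 = 0 by rewrite addr0.
  apply/eqP; rewrite eq_le subr_ge0 wb// andbT.
  by rewrite (le_trans (minV1 V _)) /= ?VG// /slack wV subrr.
Qed.

(** Greedy choice: keep a member with the largest [b], discard every member that meets it, and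
    recurse on the rest. Each discarded set meets a kept one whose [b] is at least as large. *)
Lemma vitali_finite_sets G b : set0 \notin G ->
  exists2 H : {set {set T}}, H \subset G & trivIset H /\ forall V, V \in G ->
    exists2 V', V' \in H & ~~ [disjoint V & V'] && (b V <= b V').
Proof.
have [n] := ubnP #|G|; elim: n => // n IH in G *; rewrite ltnS => Gn G0.
have [->|[V0 V0G]] := set_0Vmem G.
  exists set0; rewrite ?sub0set//; split; last by move=> V; rewrite inE.
  by rewrite /trivIset /cover !big_set0 cards0.
have [V1 /= V1G maxV1] := @arg_maxP _ _ _ V0 [pred V | V \in G] b V0G.
pose G' := [set V in G | [disjoint V1 & V]].
have subG' : G' \subset G by apply/subsetP => V; rewrite inE => /andP[].
have G'0 : set0 \notin G' by apply: contra G0; exact: (subsetP subG').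
have ltG' : (#|G'| < n)%N.
  rewrite (leq_trans _ Gn)// proper_card//; apply/properP; split=> //.
  (* Being nonempty, [V1] is not disjoint from itself, so it leaves [G'] and the cardinality
     drops. *)
  exists V1 => //; rewrite inE V1G -setI_eq0 setIid/=.
  by apply: contraNneq G0 => <-.
have [H HG' [tH Hcov]] := IH _ ltG' G'0.
exists (V1 |: H).
  by rewrite subUset sub1set V1G (subset_trans HG').
split.
  have [] // := @trivIsetU1 _ V1 H _ tH.
    by move=> V /(subsetP HG'); rewrite inE => /andP[].
  by apply: contra G'0; exact: (subsetP HG').
move=> V VG; have [dV|ndV] := boolP [disjoint V1 & V].
  have [|V' V'H V'P] := Hcov V; first by rewrite inE VG.
  by exists V' => //; rewrite inE V'H orbT.
exists V1; first by rewrite !inE eqxx.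
by rewrite disjoint_sym ndV /=; apply: maxV1.
Qed.

(* The pairs in [s] are the centres and the truncated diameters max(phi, |V|) of
   a disjoint Vitali subfamily of the sets V saturated by [w]. *)
Lemma frostman_weights (D : T -> T -> R) (g : R -> R) (t0 : T) (phi lam : R) :
  (forall x, D x x = 0) -> (forall x y z, D x z <= D x y + D y z) ->
  0 < phi -> phi <= lam -> (forall x, 0 <= g x) ->
  {in >= phi, {homo g : x y / x <= y}} ->
  exists w : T -> R, [/\ forall t, 0 <= w t,
    forall V d, phi <= d <= lam -> {in V &, forall t u, D t u <= d} ->
      \sum_(t in V) w t <= g d &
    exists s : seq (T * R), [/\ forall q, q \in s -> phi <= q.2 <= lam,
      forall t, exists2 q, q \in s & D q.1 t <= 2 * q.2 &
      \sum_(q <- s) g q.2 <= \sum_t w t]].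
Proof.
move=> Dxx Dtri phi0 phi_lam g0 gmono.
(* The default value [phi] of the maximum performs the truncation from below; singletons get exactly
   [phi], so they belong to [G] below and cover [T]. *)
pose rho (V : {set T}) := \big[Order.max/phi]_(q in setX V V) D q.1 q.2.
have rho_ge V : phi <= rho V by exact: bigmax_ge_id.
have rho_le (V : {set T}) d : phi <= d ->
    {in V &, forall t u, D t u <= d} -> rho V <= d.
  move=> phid dV; apply: bigmax_le => // -[t u].
  by rewrite inE /= => /andP[tV uV]; exact: dV.
have D_le (V : {set T}) t u : t \in V -> u \in V -> D t u <= rho V.
  move=> tV uV; apply: (le_bigmax_cond _ (fun q => D q.1 q.2) (j := (t, u))).
  by rewrite inE tV.
pose G := [set V : {set T} | (V != set0) && (rho V <= lam)].
have rho1 t : rho [set t] = phi.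
  apply/eqP; rewrite eq_le rho_ge andbT rho_le// => u v.
  by rewrite !inE => /eqP-> /eqP->; rewrite Dxx ltW.
have [V _|t|w [w0 wG tight]] := @saturating_weights G (g \o rho).
- exact: g0.
- exists [set t]; rewrite inE// rho1 phi_lam andbT.
  by apply/set0Pn; exists t; rewrite inE.
exists w; split=> //.
  move=> V d /andP[phid dlam] Vd.
  have [->|V0] := eqVneq V set0; first by rewrite big_set0 g0.
  have Vrho := rho_le V d phid Vd.
  rewrite (le_trans (wG V _))//; first by rewrite inE V0 (le_trans Vrho).
  by apply: gmono => //=; exact: rho_ge.
(* Only saturated sets enter the Vitali selection, so that the [g]-sum over the disjoint family is
   the weight of its union. *)
pose Gt := [set V in G | \sum_(u in V) w u == g (rho V)].
have Gt0 : set0 \notin Gt by rewrite !inE eqxx.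
have [H HGt [tH Hcov]] := vitali_finite_sets rho Gt0.
have HP (V : {set T}) : V \in H ->
    [/\ V != set0, rho V <= lam & \sum_(u in V) w u = g (rho V)].
  by move=> /(subsetP HGt); rewrite !inE => /andP[/andP[? ?] /eqP].
pose c (V : {set T}) := odflt t0 [pick t in V].
have cP V : V \in H -> c V \in V.
  by case/HP=> /set0Pn[t tV] _ _; rewrite /c; case: pickP => // /(_ t); rewrite tV.
exists [seq (c V, rho V) | V <- enum H]; split.
- move=> _ /mapP[V VH ->] /=; rewrite mem_enum in VH.
  by rewrite rho_ge; have [_ ->] := HP V VH.
- move=> t; have [V [VG tV wV]] := tight t.
  have [|V' V'H /andP[ndV rhoV]] := Hcov V; first by rewrite inE VG wV/=.
  exists (c V', rho V') => /=; first by apply: map_f; rewrite mem_enum.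
  (* Through a common point [u] of [V] and [V'], the distance from [c V'] to [t] is at most
     [rho V' + rho V], hence at most twice [rho V']. *)
  move: ndV => /pred0Pn[u /andP[/= uV uV']].
  rewrite (le_trans (Dtri _ u _))// mulr_natl mulr2n lerD//; first by rewrite D_le ?cP.
  by rewrite (le_trans _ rhoV)// D_le.
- rewrite big_map big_enum /=.
  rewrite (eq_bigr (fun V : {set T} => \sum_(u in V) w u)); last first.
    by move=> V /HP[].
  rewrite -big_trivIset//= [leRHS](bigID (mem (cover H)))/= lerDl.
  by rewrite sumr_ge0.
Qed.

Lemma ler_sum_cover (Y : eqType) (s : seq Y)
    (P : Y -> pred T) (V : pred T) (w : T -> R) :
  (forall t, 0 <= w t) -> (forall t, V t -> exists2 y, y \in s & P y t) ->
  \sum_(t | V t) w t <= \sum_(y <- s) \sum_(t | P y t) w t.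
Proof.
move=> w0 VP; under [leRHS]eq_bigr do rewrite big_mkcond.
rewrite exchange_big [leLHS]big_mkcond; apply: ler_sum => t _.
case: ifPn => Vt; last by rewrite sumr_ge0// => y _; case: ifP.
have [y ys Pyt] := VP t Vt.
by rewrite (big_rem y ys)/= Pyt lerDl sumr_ge0// => z _; case: ifP.
Qed.

End FiniteFamilies.

From mathcomp Require Import all_classical all_reals all_analysis.

Import numFieldNormedType.Exports.

Local Open Scope classical_set_scope.

(** * Diameters and closures *)

Section Diameter.
Context {R : realType} {X : pointedMetricType R}.
Implicit Types (A : set X) (x y : X) (d : R).

Lemma mdist_le_diameter A x y : A x -> A y -> ((mdist x y)%:E <= diameter A)%E.
Proof.
move=> Ax Ay; rewrite /diameter le_max; apply/orP; right.
by apply: ereal_sup_ubound; exists (x, y).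
Qed.

Lemma diameter_le A d : 0 <= d ->
  (forall x y, A x -> A y -> mdist x y <= d) -> (diameter A <= d%:E)%E.
Proof.
move=> d0 Ad; rewrite /diameter ge_max lee_fin d0 /=.
by apply: ge_ereal_sup => _ [[x y] [/= Ax Ay] <-]; rewrite lee_fin Ad.
Qed.

(** Allows an arbitrary cover to be replaced by a closed, hence Borel, one. Points of the closure
    are approximated within [e / 2] by points of [A]. *)
Lemma diameter_closure A : diameter (closure A) = diameter A.
Proof.
apply/eqP; rewrite eq_le; apply/andP; split; last first.
  rewrite {1}/diameter ge_max; apply/andP; split.
    by rewrite /diameter le_max lexx.
  apply: ge_ereal_sup => _ [[x y] [/= Ax Ay] <-].
  by apply: mdist_le_diameter; exact: subset_closure.
have : (0 <= diameter A)%E by rewrite /diameter le_max lexx.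
case dA : (diameter A) => [d| |]; [|by move=> _; rewrite leey|by rewrite leeNy_eq].
rewrite lee_fin => d0; apply: diameter_le => // x y Ax Ay.
apply/ler_addgt0Pl => e e0.
have e20 : 0 < e / 2 by rewrite divr_gt0.
have [x' [Ax']] := Ax _ (nbhsx_ballx x _ e20).
have [y' [Ay']] := Ay _ (nbhsx_ballx y _ e20).
rewrite !ballEmdist/= => yy' xx'.
have := mdist_le_diameter Ax' Ay'; rewrite dA lee_fin => x'y'.
have := metric_triangle x x' y; have := metric_triangle x' y' y.
by rewrite (metric_sym y' y); lra.
Qed.

Lemma between_diameter A (a b : R) : (a%:E <= diameter A <= b%:E)%E ->
  exists2 d, diameter A = d%:E & a <= d <= b.
Proof.
case: (diameter A) => [d| |] //=; first by rewrite !lee_fin => ?; exists d.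
by rewrite leye_eq andbF.
Qed.

End Diameter.

(** * Discrete probabilities and the mass distribution principle *)

Section DiscreteMeasure.
Context {R : realType} {X : pointedMetricType R}.

Lemma open_measurable_borel (U : set (borelType X)) :
  open (U : set X) -> measurable U.
Proof. exact: sub_sigma_algebra. Qed.

Lemma closed_measurable_borel (U : set (borelType X)) :
  closed (U : set X) -> measurable U.
Proof.
move=> cU; rewrite -(setCK U); apply: measurableC.
by apply: open_measurable_borel; exact: closed_openC.
Qed.

Lemma discrete_probability n (p : 'I_n -> X) (w : 'I_n -> R) :
  (forall i, 0 <= w i) -> 0 < \sum_i w i ->
  exists mu : probability (borelType X) R, forall U : set (borelType X),
    mu U = ((\sum_(i | (p i : borelType X) \in U) w i) / \sum_i w i)%:E.
Proof.
move=> w0 W0.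
(* A finite sum of measures is indexed by natural numbers, so the weighted Dirac masses are extended
   by the zero measure beyond [n]. *)
pose m k : {measure set (borelType X) -> \bar R} :=
  if insub k is Some i then mscale (NngNum (w0 i)) (dirac (p i : borelType X))
  else mzero.
pose M : {measure set (borelType X) -> \bar R} := msum m n.
have mE U : M U = (\sum_(i | (p i : borelType X) \in U) w i)%:E.
  transitivity (\sum_(k < n) m k U)%E => //; rewrite -sumEFin [in RHS]big_mkcond.
  apply: eq_bigr => i _.
  rewrite /m valK; transitivity ((w i)%:E * dirac (p i : borelType X) U)%E => //.
  rewrite diracE; case: ifPn => _.
    by rewrite mule1.
  by rewrite mule0.
have MT : M setT = (\sum_i w i)%:E.
  by rewrite mE; congr (_%:E); apply: eq_bigl => i; rewrite in_setT.
(* The Dirac mass at [point] is only the fallback for total mass zero or infinity, which is excluded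
   here. *)
exists (mnormalize M (dirac (point : borelType X))) => U.
by rewrite /= /mnormalize MT eqe gt_eqF//= mE -EFinM.
Qed.

(** The support consists of the points of positive weight: it is finite, hence closed, and a closed
    set with null complement must contain every atom. *)
Lemma discrete_supported n (p : 'I_n -> X) (w : 'I_n -> R) (F : set X)
    (mu : probability (borelType X) R) :
  (forall i, 0 <= w i) -> 0 < \sum_i w i -> (forall i, F (p i)) ->
  (forall U : set (borelType X),
    mu U = ((\sum_(i | (p i : borelType X) \in U) w i) / \sum_i w i)%:E) ->
  supported_in mu F.
Proof.
move=> w0 W0 Fp muE; exists (p @` [set i | 0 < w i]); split; last first.
  by move=> _ [i _ <-].
pose nu : {measure set (borelType X) -> \bar R} := mu.
have {}muE (U : set (borelType X)) :
  nu U = ((\sum_(i | (p i : borelType X) \in U) w i) / \sum_i w i)%:E := muE U.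
rewrite -[mu : {measure set (borelType X) -> \bar R}]/nu; split.
- apply: (accessible_finite_set_closed).1.
    by apply: hausdorff_accessible; exact: metric_hausdorff.
  by apply: finite_image; exact: finite_finset.
- rewrite muE big1 ?mul0r// => i; rewrite inE /= => pi.
  by apply/eqP; rewrite eq_le w0 andbT leNgt; apply/negP => wi; apply: pi; exists i.
- move=> A cA; rewrite muE => -[] /eqP; rewrite mulf_eq0 invr_eq0 (gt_eqF W0) orbF.
  rewrite psumr_eq0// => /allP wA _ [i wi <-]; apply: contrapT => nA.
  have := wA i; rewrite mem_index_enum => /(_ isT); rewrite mem_set//= => /eqP wi0.
  by rewrite /= wi0 ltxx in wi.
Qed.

Lemma supported_probability_exists (F : set X) : F !=set0 ->
  exists mu : probability (borelType X) R, supported_in mu F.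
Proof.
case=> x Fx; have W0 : 0 < \sum_(i < 1) (1 : R) by rewrite big_ord1.
have [mu muE] := @discrete_probability 1 (fun=> x) (fun=> 1) (fun=> ler01) W0.
by exists mu; apply: discrete_supported muE.
Qed.

(** The measure bound is applied to the closures of the covering sets. Their diameters lie in (0, 1]
    because [d <= 1], so the exponent [s] can be lowered to [t]. *)
Lemma mass_distribution (F : set X) (Phi : R -> R) (d s t C eps : R)
    (mu : probability (borelType X) R) :
  0 < Phi d -> d <= 1 -> t <= s -> 0 < C -> supported_in mu F ->
  (forall U : set (borelType X), measurable U ->
    ((Phi d)%:E <= diameter (U : set X) <= d%:E)%E ->
    (mu U <= C%:E * diameter (U : set X) `^ s)%E) ->
  cover_with_sum_le Phi F t eps d -> 1 <= C * eps.
Proof.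
move=> Phi0 d1 ts C0 [S [[cS muS _] SF]] muC [I [U [FU Ud Ueps]]].
(* Indices outside [I] receive the empty set, so that countable subadditivity applies over all
   natural numbers. *)
pose V k : set (borelType X) := if k \in I then closure (U k) else set0.
have mV k : measurable (V k).
  rewrite /V; case: ifP => // _; apply: closed_measurable_borel.
  exact: closed_closure.
have mS : measurable (S : set (borelType X)) by exact: closed_measurable_borel.
have muS1 : mu S = 1%E.
  have := probability_setC mu mS; rewrite muS => /eqP.
  have := fin_num_measure mu _ mS; case: (mu S) => // r _.
  by rewrite eqe eq_sym subr_eq0 => /eqP[->].
have SV : S `<=` \bigcup_k V k.
  move=> x /SF/FU[k Ik Ukx]; exists k => //.
  by rewrite /V mem_set//; exact: subset_closure.
rewrite -lee_fin -muS1 (le_trans (measure_sigma_subadditive mu mV mS SV))//.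
rewrite nneseries_esumT//.
apply: (@le_trans _ _ (\esum_(i in I) (C%:E * diameter (U i) `^ t))%E); last first.
  rewrite esum_mkcond -nneseries_esumT; last first.
    by move=> k; case: ifP => // _; rewrite mule_ge0 ?poweR_ge0// lee_fin ltW.
  under eq_eseriesr => k _.
    rewrite (_ : (if _ then _ else _) =
      C%:E * (if k \in I then diameter (U k) `^ t else 0))%E; last first.
      by case: ifP => // _; rewrite mule0.
    over.
  rewrite nneseriesZl//; last by move=> k _; case: ifP => // _; rewrite poweR_ge0.
  rewrite nneseries_esumT; last by move=> k; case: ifP => // _; rewrite poweR_ge0.
  by rewrite -esum_mkcond EFinM lee_wpmul2l// lee_fin ltW.
rewrite [leRHS]esum_mkcond; apply: le_esum => k _; rewrite /V.
case: ifPn => kI; last by rewrite measure0.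
have {}kI : I k by rewrite inE in kI.
have [e eE /andP[Phie ed]] := between_diameter (Ud k kI).
have cU : diameter (closure (U k)) = e%:E by rewrite diameter_closure.
have e0 : 0 < e by rewrite (lt_le_trans Phi0).
apply: (le_trans (muC _ _ _)).
- by apply: closed_measurable_borel; exact: closed_closure.
- by rewrite cU !lee_fin Phie.
- rewrite cU eE !poweR_EFin lee_wpmul2l//; first by rewrite lee_fin ltW.
  by rewrite lee_fin ger_powR// e0 (le_trans ed).
Qed.

End DiscreteMeasure.

(** * Frostman measures at a fixed scale *)

Section Frostman.
Context {R : realType} {X : pointedMetricType R}.
Implicit Types (F : set X) (Phi : R -> R).

Lemma diameter_ball_le (x : X) (r : R) : 0 <= r ->
  (diameter (ball x r) <= (2 * r)%:E)%E.
Proof.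
move=> r0; apply: diameter_le => [|y z]; first by rewrite mulr_ge0.
rewrite ballEmdist/= => xy xz; have := metric_triangle y x z.
by rewrite (metric_sym y x); lra.
Qed.

Lemma diameter_ball_ge (c : R) (x : X) (r : R) : 0 < r ->
  ball x r `\` ball x (c * r) !=set0 -> ((c * r)%:E <= diameter (ball x r))%E.
Proof.
move=> r0 [z [xz]]; rewrite [in X in ~ X]ballEmdist/= => /negP; rewrite -leNgt => crz.
apply: (@le_trans _ _ (mdist x z)%:E); first by rewrite lee_fin.
by apply: mdist_le_diameter => //; exact: ballxx.
Qed.

(** Turns a finite list of balls into an indexed cover. The true diameters are only known to be at
    most twice the radii, which suffices for the sum since [s] is nonnegative. *)
Lemma ball_cover_with_sum_le Phi F (s eps d a : R) (r : seq (X * R)) :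
  0 <= s -> 0 < Phi d ->
  (forall x, F x -> exists2 q, q \in r & ball q.1 (a * q.2) x) ->
  (forall q, q \in r -> 0 <= a * q.2 /\
    ((Phi d)%:E <= diameter (ball q.1 (a * q.2)) <= d%:E)%E) ->
  \sum_(q <- r) (2 * (a * q.2)) `^ s <= eps ->
  cover_with_sum_le Phi F s eps d.
Proof.
move=> s0 Phi0 Fr rd sum_le; pose q0 : X * R := (point, 0).
exists `I_(size r).
exists (fun k => ball (nth q0 r k).1 (a * (nth q0 r k).2)); split.
- move=> x /Fr[q qr xq]; exists (index q r); first by rewrite /= index_mem.
  by rewrite nth_index.
- by move=> k /= kr; exact: (rd _ (mem_nth _ kr)).2.
- rewrite esum_fset//; last by move=> k _; exact: poweR_ge0.
  rewrite -fsbig_ord; move: sum_le; rewrite -lee_fin; apply: le_trans.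
  rewrite (big_nth q0) big_mkord -sumEFin; apply: lee_sum => k _.
  have [q0' qd] := rd _ (mem_nth q0 (ltn_ord k)).
  have [e eE /andP[Phie ed]] := between_diameter qd.
  have := diameter_ball_le (nth q0 r k).1 q0'.
  rewrite eE poweR_EFin !lee_fin => e2; rewrite ge0_ler_powR// nnegrE.
    by rewrite (le_trans (ltW Phi0)).
  by rewrite mulr_ge0.
Qed.

(** The constants [eta] and [B] are chosen before [d] and [eps]. This uniformity serves both
    dimensions, which differ only in how the scales are quantified. *)
Lemma frostman (Delta : R) Phi F (s : R) :
  (exists x y : X, x <> y) -> uniformly_perfect X -> admissible Delta Phi ->
  F !=set0 -> totally_bounded_set F -> (assouad_dimension F < +oo)%E -> 0 <= s ->
  exists eta B : R, [/\ 0 < eta, 0 < B & forall d eps : R,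
    0 < d < eta -> d < Delta -> 0 < eps -> ~ cover_with_sum_le Phi F s eps d ->
    exists mu : probability (borelType X) R, supported_in mu F /\
      forall U : set (borelType X), measurable U ->
        ((Phi d)%:E <= diameter (U : set X) <= d%:E)%E ->
        (mu U <= (B / eps)%:E * diameter (U : set X) `^ s)%E].
Proof.
move=> [x1 [x2 x12]] [c [c0 c1 perf]] [Delta0 _ Phid Phicvg] [x0 Fx0] Ftb dimA s0.
have [_ [a [Ca [Ca0 assouad]] <-] _] := ereal_inf_lt dimA.
(* Since [A > 4], a ball of radius [A * q.2] contains all points within [2 * q.2 + phi] of its
   centre; since [c * A = 4], uniform perfectness gives it diameter at least [4 * q.2], hence at
   least [phi]. *)
pose A := 4 / c.
have A4 : 4 < A by rewrite /A ltr_pdivlMr//; lra.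
have cA : c * A = 4 by rewrite /A mulrC divfK// gt_eqF.
have A0 : 0 < A by lra.
(* A positive lower bound for the diameter of the space: scales below [D0] keep the radii in the
   range of uniform perfectness. *)
pose D0 := mdist x1 x2.
have D00 : 0 < D0 by rewrite /D0 mdist_gt0; exact/eqP.
have D0X : (D0%:E <= diameter [set: X])%E by exact: mdist_le_diameter.
have A20 : 0 < 2 * A by rewrite mulr_gt0.
have [eta0 eta00 Phi_small] : exists2 eta0, 0 < eta0 &
    forall d, 0 < d < eta0 -> Phi d / d < (2 * A)^-1.
  move/cvgrPdist_lt : Phicvg => /(_ (2 * A)^-1).
  rewrite invr_gt0 => /(_ A20)[e /= e0 He]; exists e => // d /andP[d0 de].
  have := He d; rewrite /= !sub0r !normrN gtr0_norm// => /(_ de d0).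
  by apply: le_lt_trans; exact: ler_norm.
(* Bounds the number of balls of radius [lam / 2] needed for a ball of radius [2 * d], as
   [2 * d / lam = 4 * A]. The added 1 makes the bound strict and ensures [1 <= M]. *)
pose M := Ca * (4 * A) `^ a + 1.
have M1 : 1 <= M by rewrite /M lerDr mulr_ge0 ?powR_ge0// ltW.
have M0 : 0 < M by lra.
have A2s : 0 < (2 * A) `^ s by rewrite powR_gt0.
exists (Order.min eta0 D0), (M * (2 * A) `^ s); split.
- by rewrite lt_min eta00.
- by rewrite mulr_gt0.
move=> d eps /andP[d0]; rewrite lt_min => /andP[deta dD0] dDelta eps0 ncov.
have /andP[phi0 phid] : 0 < Phi d <= d by apply: Phid; rewrite d0.
set phi := Phi d in phi0 phid.
(* Chosen so that a ball of radius [A * lam] has diameter at most [d]. *)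
pose lam := d / (2 * A).
have lam0 : 0 < lam by rewrite divr_gt0.
have Alam : 2 * (A * lam) = d by rewrite mulrA /lam mulrC divfK// gt_eqF.
have phi_lam : phi <= lam.
  have := Phi_small d; rewrite d0 deta => /(_ isT) /ltW.
  by rewrite ler_pdivrMr// /lam mulrC.
(* Covering numbers use balls of half the given scale, so the scale [2 * phi] yields a [phi]-net. *)
have [|_ [n [t [tn tF Ft]] <-] _] := @ereal_inf_lt _ _ _ (Ftb (2 * phi) _).
  by rewrite mulr_gt0.
have {}Ft x : F x -> exists2 i : 'I_(size t), true & mdist (tnth (in_tuple t) i) x < phi.
  move=> /Ft[y yt]; rewrite mulrC mulKf// ballEmdist/= => yx.
  have it : (index y t < size t)%N by rewrite index_mem.
  by exists (Ordinal it) => //; rewrite (tnth_nth y) nth_index.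
pose p := tnth (in_tuple t).
have Fp i : F (p i) by apply: tF; rewrite /= mem_tnth.
have [i0 _ _] := Ft _ Fx0.
(* The weights live on positions in the list [t], where distinct indices at distance zero are
   harmless. *)
have [|i j k||w [w0 wV [r [rlam rcov rsum]]]] :=
  @frostman_weights _ _ (fun i j => mdist (p i) (p j)) (fun x => x `^ s) i0 phi lam
    _ _ phi0 phi_lam (fun=> powR_ge0 _ _).
- by move=> i; exact: mdistxx.
- exact: metric_triangle.
- move=> x /= phix y xy; rewrite ge0_ler_powR// nnegrE.
    by rewrite (le_trans (ltW phi0)).
  by rewrite (le_trans (ltW phi0))// (le_trans phix).
pose W := \sum_i w i.
have W_large : eps < (2 * A) `^ s * W.
  rewrite ltNge; apply/negP => W_small; apply: ncov.
  apply: (@ball_cover_with_sum_le _ _ _ _ _ A [seq (p q.1, q.2) | q <- r]) => //.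
  - move=> x Fx; have [i _ ix] := Ft x Fx; have [q qr qi] := rcov i.
    exists (p q.1, q.2) => /=; first exact: (map_f (fun q => (p q.1, q.2))).
    rewrite ballEmdist/=; have /andP[q1 q2] := rlam q qr.
    have := metric_triangle (p q.1) (p i) x.
    have : 4 * q.2 <= A * q.2 by rewrite ler_pM2r ?ltW//; lra.
    by move: ix qi; rewrite -/(p i); lra.
  - move=> _ /mapP[q qr ->] /=; have /andP[q1 q2] := rlam q qr.
    have q0 : 0 < q.2 by lra.
    have Aq : A * q.2 <= A * lam by rewrite ler_pM2l.
    have Aq0 : 0 < A * q.2 by rewrite mulr_gt0.
    split; first exact: ltW.
    apply/andP; split.
      apply: (@le_trans _ _ (c * (A * q.2))%:E).
        by rewrite lee_fin mulrA cA -/phi; lra.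
      apply: diameter_ball_ge => //; apply: perf => //.
      by apply: lt_le_trans D0X; rewrite lte_fin; lra.
    apply: le_trans (diameter_ball_le _ (ltW Aq0)) _.
    by rewrite lee_fin; lra.
  - rewrite big_map/= (le_trans _ W_small)//.
    rewrite (le_trans _ (ler_wpM2l (ltW A2s) rsum))// mulr_sumr.
    rewrite big_seq [leRHS]big_seq; apply: ler_sum => q qr.
    rewrite mulrA powRM//; first by rewrite ltW.
    by have /andP[q1 q2] := rlam q qr; lra.
have W0 : 0 < W by rewrite -(pmulr_rgt0 _ A2s) (lt_trans eps0).
have [mu muE] := discrete_probability p w0 W0.
exists mu; split; first exact: discrete_supported muE.
move=> U mU Ud; have [e eE /andP[phie ed]] := between_diameter Ud.
have e0 : 0 < e by exact: lt_le_trans phie.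
rewrite eE poweR_EFin muE -EFinM lee_fin -/W.
have UleM : \sum_(i | (p i : borelType X) \in U) w i <= M * e `^ s.
  pose V := [set i | (p i : borelType X) \in U]%SET.
  have VE : \sum_(i | (p i : borelType X) \in U) w i = \sum_(i in V) w i.
    by apply: eq_bigl => i; rewrite inE.
  have Ve : {in V &, forall i j, mdist (p i) (p j) <= e}.
    move=> i j; rewrite !inE => iU jU.
    by rewrite -lee_fin -eE; apply: mdist_le_diameter.
  have es0 : 0 <= e `^ s by exact: powR_ge0.
  (* Up to [lam] the weights obey the bound directly. For larger [e], the net points in [U] lie in
     one ball of radius [2 * d], which is split into fewer than [M] pieces of diameter at most
     [lam]. *)
  have [elam|lame] := leP e lam.
    rewrite VE (le_trans (wV V e _ Ve)) ?phie//.
    by rewrite ler_peMl.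
  have [V0|[i1 i1V]] := finset.set_0Vmem V.
    by rewrite VE V0 finset.big_set0 mulr_ge0// ltW.
  have i1U : U (p i1) by move: i1V; rewrite !inE.
  have lam2d : lam < 2 * d by rewrite -Alam; nra.
  have cov : (covering_number lam (ball (p i1) (2 * d) `&` F) < M%:E)%E.
    apply: le_lt_trans (assouad _ _ _ (Fp i1) lam0 lam2d) _.
    have dlam : d / lam = 2 * A by rewrite /lam invf_div mulrCA divff ?gt_eqF// mulr1.
    by rewrite lte_fin /M (_ : 2 * d / lam = 4 * A) ?ltrDl// -mulrA dlam; lra.
  have [_ [m [v [vm _ Fv]] <-]] := ereal_inf_lt cov.
  rewrite lte_fin => mM.
  apply: (@le_trans _ _
      (\sum_(y <- v) \sum_(i in [set i | mdist y (p i) < lam / 2]%SET) w i)).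
    rewrite VE; apply: ler_sum_cover => // i iV.
    have [|y yv yi] := Fv (p i).
      split; last exact: Fp.
      by rewrite ballEmdist/=; have := Ve _ _ i1V iV; lra.
    by exists y => //; move: yi; rewrite ballEmdist/= inE.
  apply: (@le_trans _ _ (\sum_(y <- v) lam `^ s)).
    apply: ler_sum => y _; apply: wV; first by rewrite phi_lam lexx.
    move=> i j; rewrite !inE => yi yj.
    by have := metric_triangle (p i) y (p j); rewrite (metric_sym (p i) y); lra.
  rewrite big_const_seq count_predT iter_addr_0 -mulr_natl vm.
  apply: ler_pM => //; first exact: powR_ge0.
    exact: ltW.
  by apply: ge0_ler_powR; rewrite ?nnegrE// ltW.
have Weps : 1 <= (2 * A) `^ s * W / eps by rewrite ler_pdivlMr// mul1r ltW.
rewrite ler_pdivrMr// (le_trans UleM)//.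
rewrite [leRHS](_ : _ = M * e `^ s * ((2 * A) `^ s * W / eps)); last by ring.
by rewrite ler_peMr// mulr_ge0 ?powR_ge0// ltW.
Qed.

End Frostman.

(** * From scales to dimensions *)

(** If the supremum were smaller than the infimum, a real [s] strictly between would fail [P], hence
    satisfy [Q] and lie below the supremum. [Q 0] guarantees that such an [s] is nonnegative. *)
Lemma ereal_inf_eq_sup (R : realType) (P Q : R -> Prop) : Q 0 ->
  (forall s t, 0 <= s -> 0 <= t -> Q s -> P t -> s <= t) ->
  (forall s, 0 <= s -> ~ P s -> Q s) ->
  ereal_inf [set s%:E | s in [set s : R | 0 <= s /\ P s]] =
  ereal_sup [set s%:E | s in [set s : R | 0 <= s /\ Q s]].
Proof.
move=> Q0 QP nPQ; apply/eqP; rewrite eq_le; apply/andP; split; last first.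
  apply: ge_ereal_sup => _ [s [s0 Qs] <-].
  by apply/ereal_infP => _ [t [t0 Pt] <-]; rewrite lee_fin; exact: QP.
have Q0le : (0%:E <= ereal_sup [set s%:E | s in [set s : R | (0 <= s)%R /\ Q s]])%E.
  by apply: ereal_sup_ubound; exists 0.
set E := ereal_sup _ in Q0le *; set I := ereal_inf _.
rewrite leNgt; apply/negP => EI.
have : exists2 s : R, (E < s%:E)%E & (s%:E < I)%E.
  case: E Q0le EI => [e| |] //= _; last by rewrite ltNge leey.
  case: I => [i| |] //; last by move=> _; exists (e + 1); rewrite ?ltry// lte_fin; lra.
  by rewrite lte_fin => ei; exists ((e + i) / 2); rewrite lte_fin; lra.
case=> s Es sI; have s0 : 0 <= s by rewrite -lee_fin (le_trans Q0le)// ltW.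
have [Ps|nPs] := pselect (P s).
  have : (I <= s%:E)%E by apply: ereal_inf_lbound; exists s.
  by rewrite leNgt sI.
have : (s%:E <= E)%E by apply: ereal_sup_ubound; exists s => //; split => //; exact: nPQ.
by rewrite leNgt Es.
Qed.

Theorem theorem5p3 (R : realType) (X : pointedMetricType R)
    (Delta : R) (Phi : R -> R) (F : set X) :
  (exists x y : X, x <> y) ->
  uniformly_perfect X ->
  admissible Delta Phi ->
  F !=set0 ->
  totally_bounded_set F ->
  (assouad_dimension F < +oo)%E ->
  upper_intermediate_dimension Delta Phi F =
    ereal_sup [set s%:E | s in [set s : R | 0 <= s /\
      exists C : R, 0 < C /\
      forall d1 : R, 0 < d1 ->
      exists d : R, [/\ 0 < d < d1, d < Delta &
      exists mu : probability (borelType X) R, supported_in mu F /\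
        forall U : set (borelType X), measurable U ->
          ((Phi d)%:E <= diameter (U : set X) <= d%:E)%E ->
          (mu U <= C%:E * diameter (U : set X) `^ s)%E]]]
  /\
  lower_intermediate_dimension Delta Phi F =
    ereal_sup [set s%:E | s in [set s : R | 0 <= s /\
      exists C d1 : R, [/\ 0 < C, 0 < d1 &
      forall d : R, 0 < d < d1 -> d < Delta ->
      exists mu : probability (borelType X) R, supported_in mu F /\
        forall U : set (borelType X), measurable U ->
          ((Phi d)%:E <= diameter (U : set X) <= d%:E)%E ->
          (mu U <= C%:E * diameter (U : set X) `^ s)%E]]].
Proof.
move=> X2 Xperf adm F0 Ftb dimF.
have [Delta0 _ Phid _] := adm.
have frost s := frostman X2 Xperf adm F0 Ftb dimF (s := s).
have [mu0 mu0F] := @supported_probability_exists R X F F0.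
(* The exponent 0 is always attained with constant 1, which makes both suprema nonnegative. *)
have mu0_le (U : set (borelType X)) : measurable U ->
    (mu0 U <= 1%:E * diameter (U : set X) `^ 0)%E.
  by move=> mU; rewrite poweRe0 mule1; exact: probability_le1.
split; apply: ereal_inf_eq_sup.
- exists 1; split=> // d1 d10; exists (Order.min d1 Delta / 2).
  have m0 : 0 < Order.min d1 Delta by rewrite lt_min d10.
  have [m1 m2] : Order.min d1 Delta <= d1 /\ Order.min d1 Delta <= Delta.
    by rewrite !ge_min !lexx orbT.
  split; [by lra|by lra|].
  by exists mu0; split=> // U mU _; exact: mu0_le.
- move=> s t s0 t0 [C [C0 Cmu]] Pt; rewrite leNgt; apply/negP => ts.
  (* With this [eps] the mass distribution principle would give [1 <= 1 / 2]. *)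
  have eps0 : 0 < (2 * C)^-1 by rewrite invr_gt0 mulr_gt0.
  have [d0 [/andP[d00 d01] d0D dcov]] := Pt _ eps0.
  have [d [/andP[dgt0 dd0] dD [mu [muF muC]]]] := Cmu _ d00.
  have /andP[phi0 _] : 0 < Phi d <= d by apply: Phid; rewrite dgt0.
  have : cover_with_sum_le Phi F t (2 * C)^-1 d by apply: dcov; rewrite dgt0.
  move/(mass_distribution phi0 (ltW (lt_le_trans dd0 d01)) (ltW ts) C0 muF muC).
  by rewrite invfM mulrCA divff ?gt_eqF//; lra.
- move=> s s0 nP; have [eta [B [eta0 B0 fr]]] := frost s s0.
  (* Negating the upper condition gives a single [eps] with cover-free scales arbitrarily close to
     0; fixing [eps] makes the constant [B / eps] uniform. *)
  have [eps [eps0 neps]] : exists eps, 0 < eps /\ forall d0, 0 < d0 <= 1 ->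
      d0 <= Delta -> exists2 d, 0 < d < d0 & ~ cover_with_sum_le Phi F s eps d.
    apply: contrapT => H; apply: nP => eps eps0; apply: contrapT => H'.
    apply: H; exists eps; split=> // d0 d01 d0D; apply: contrapT => H''.
    apply: H'; exists d0; split=> // d dd0; apply: contrapT => H'.
    by apply: H''; exists d.
  exists (B / eps); split; first exact: divr_gt0.
  move=> d1 d10; pose d0 := Order.min (Order.min d1 eta) (Order.min 1 Delta).
  have d00 : 0 < d0 by rewrite !lt_min d10 eta0 Delta0 ltr01.
  have [d0d1 d0eta d01 d0D] : [/\ d0 <= d1, d0 <= eta, d0 <= 1 & d0 <= Delta].
    by rewrite !ge_min !lexx !orbT.
  have [|//|d /andP[dgt0 dd0] ncov] := neps d0; first by rewrite d00.
  exists d; split; [by rewrite dgt0 (lt_le_trans dd0)|exact: lt_le_trans d0D|].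
  apply: fr => //; first by rewrite dgt0 (lt_le_trans dd0).
  exact: lt_le_trans d0D.
- exists 1, 1; split=> // d _ _.
  by exists mu0; split=> // U mU _; exact: mu0_le.
- move=> s t s0 t0 [C [d1 [C0 d10 Cmu]]] Pt; rewrite leNgt; apply/negP => ts.
  have eps0 : 0 < (2 * C)^-1 by rewrite invr_gt0 mulr_gt0.
  (* The minimum keeps [d] both in the range where the measures exist and below 1, as lowering the
     exponent requires. *)
  have [|d [/andP[dgt0]]] := Pt _ (Order.min d1 1) eps0.
    by rewrite lt_min d10 ltr01 ge_min lexx orbT.
  rewrite lt_min => /andP[dd1 d1'] dD.
  have [|mu [muF muC]] := Cmu d _ dD; first by rewrite dgt0.
  have /andP[phi0 _] : 0 < Phi d <= d by apply: Phid; rewrite dgt0.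
  move/(mass_distribution phi0 (ltW d1') (ltW ts) C0 muF muC).
  by rewrite invfM mulrCA divff ?gt_eqF//; lra.
- move=> s s0 nP; have [eta [B [eta0 B0 fr]]] := frost s s0.
  (* Negating the lower condition gives one [eps] for which every sufficiently small scale is
     cover-free. *)
  have [eps [d0 [eps0 d00 neps]]] : exists eps d0, [/\ 0 < eps, 0 < d0 &
      forall d, 0 < d < d0 -> d < Delta -> ~ cover_with_sum_le Phi F s eps d].
    apply: contrapT => H; apply: nP => eps d0 eps0 /andP[d00 d01].
    apply: contrapT => H'; apply: H; exists eps, d0; split=> // d dd0 dD cov.
    by apply: H'; exists d.
  exists (B / eps), (Order.min d0 eta); split; first exact: divr_gt0.
    by rewrite lt_min d00.
  move=> d /andP[dgt0]; rewrite lt_min => /andP[dd0 deta] dD.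
  by apply: fr => //; [rewrite dgt0|apply: neps; rewrite ?dgt0].
Qed.
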